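(* Let $G=(V,E)$ be a finite simple graph, let $(J_{x,y})_{x,y\in V}$ be real spin-spin coupling constants with $J_{x,y}=J_{y,x}$ for all $x,y\in V$ and $J_{x,y}=0$ whenever $\{x,y\}\notin E$, and let $(h_x)_{x\in V}$ be real local external fields. Let $P_{\beta,\varepsilon}$ denote the transition kernel of the $\varepsilon$-SCA on $\{-1,+1\}^V$ at inverse temperature $\beta\ge 0$. For any positive $\varepsilon\in(0,1]$, if $\beta$ is sufficiently small such that $$r\equiv(1-\varepsilon)+\varepsilon\max_{x\in V}\Bigg(\sum_{y\in V}\tanh\frac{\beta|J_{x,y}|}{2}\Bigg)<1,$$ then the mixing time $t_{\rm mix}(\delta)$ of the Markov chain with transition kernel $P_{\beta,\varepsilon}$ satisfies $$t_{\rm mix}(\delta)\le\Bigg\lceil\frac{\log|V|-\log\delta}{\log(1/r)}\Bigg\rceil.$$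
   Context: Spin configurations are $\boldsymbol\sigma=(\sigma_x)_{x\in V}\in\{-1,+1\}^V$. The cavity fields are $\tilde h_x(\boldsymbol\sigma)=\sum_{y\in V}J_{x,y}\sigma_y+h_x$ for $x\in V$. For inverse temperature $\beta\ge 0$ set $$p_x(\boldsymbol\sigma)=\frac{e^{-\frac{\beta}{2}\tilde h_x(\boldsymbol\sigma)\sigma_x}}{2\cosh\big(\frac{\beta}{2}\tilde h_x(\boldsymbol\sigma)\big)}.$$ The $\varepsilon$-SCA (a stochastic cellular automaton) with parameter $\varepsilon\in(0,1]$ is the discrete-time Markov chain on $\{-1,+1\}^V$ with transition kernel $$P_{\beta,\varepsilon}(\boldsymbol\sigma,\boldsymbol\tau)=\prod_{x\in V:\,\tau_x=-\sigma_x}\big(\varepsilon\,p_x(\boldsymbol\sigma)\big)\prod_{y\in V:\,\tau_y=\sigma_y}\big(1-\varepsilon\,p_y(\boldsymbol\sigma)\big),\qquad \boldsymbol\sigma,\boldsymbol\tau\in\{-1,+1\}^V.$$ That is, independently over vertices, the spin at $x$ is flipped with probability $\varepsilon p_x(\boldsymbol\sigma)$ and left unchanged otherwise. All entries of $P_{\beta,\varepsilon}$ are strictly positive, so there is a unique stationary distribution $\pi$. The mixing time (the time the system takes to be close to equilibrium, with closeness measured by $\delta$) is, in the standard sense, $$t_{\rm mix}(\delta)=\min\Big\{t\in\mathbb{Z}_{\ge 0}:\ \max_{\boldsymbol\sigma\in\{-1,+1\}^V}\big\|P_{\beta,\varepsilon}^t(\boldsymbol\sigma,\cdot)-\pi\big\|_{\rm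 TV}\le\delta\Big\},$$ where $\|\mu-\nu\|_{\rm TV}=\frac12\sum_{\boldsymbol\tau}|\mu(\boldsymbol\tau)-\nu(\boldsymbol\tau)|$ is the total variation distance.
   Formalization: Assumes r>0, since log(1/r) is undefined at r=0 (ε=1, βJ=0, where the bound would read 0 but the mixing time is 1 for small δ), and 0<δ≤1, since for large δ>|V| the bound is negative; for δ>1 the mixing time is trivially 0. *)

(* Defs.v *)
From HB Require Import structures.
From mathcomp Require Export all_boot all_order all_algebra.
From mathcomp Require Export all_classical all_reals all_analysis.
Set Implicit Arguments.
Unset Strict Implicit.
Unset Printing Implicit Defensive.
Import Order.TTheory GRing.Theory Num.Theory.
Local Open Scope classical_set_scope.
Local Open Scope ring_scope.

Definition cosh (R : realType) (x : R) : R := (expR x + expR (- x)) / 2.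
Definition sinh (R : realType) (x : R) : R := (expR x - expR (- x)) / 2.
Definition tanh (R : realType) (x : R) : R := sinh x / cosh x.

Definition kernel_pow (R : realType) (S : finType) (P : S -> S -> R)
    : nat -> S -> S -> R :=
  fix pow t s u :=
    if t is t'.+1 then \sum_(v : S) P s v * pow t' v u else (s == u)%:R.

Definition is_stationary (R : realType) (S : finType) (P : S -> S -> R)
    (pi : {ffun S -> R}) : Prop :=
  [/\ forall s, 0 <= pi s,
      \sum_(s : S) pi s = 1 &
      forall u, \sum_(s : S) pi s * P s u = pi u].

(* When all entries of the stochastic kernel P are positive there is exactly
   one stationary distribution, and this is it; the default 0, which is not a
   probability distribution, is returned only when there is none. *)
Definition stationary_distribution (R : realType) (S : finType)
    (P : S -> S -> R) : {ffun S -> R} :=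
  xget [ffun=> 0] [set pi | is_stationary P pi].

Definition tv_distance (R : realType) (S : finType) (mu nu : S -> R) : R :=
  2^-1 * \sum_(u : S) `|mu u - nu u|.

(* Total variation distances are nonnegative, so the initial value 0 does not
   affect the maximum. *)
Definition distance_to_equilibrium (R : realType) (S : finType)
    (P : S -> S -> R) (t : nat) : R :=
  \big[Num.max/0]_(s : S)
     tv_distance (kernel_pow P t s) (stationary_distribution P).

(* The infimum of a nonempty set of natural numbers is its minimum; the value
   is +oo if no t qualifies. *)
Definition mixing_time (R : realType) (S : finType) (P : S -> S -> R)
    (delta : R) : \bar R :=
  ereal_inf [set (t%:R)%:E | t in [set t : nat |
                                    distance_to_equilibrium P t <= delta]].

(* {-1,+1}^V, with true standing for +1 and false for -1; hence the flip of a
   spin is boolean negation. *)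
Definition spin_config (V : finType) := {ffun V -> bool}.
Definition spin (R : realType) (V : finType) (sigma : spin_config V) (x : V)
    : R := if sigma x then 1 else -1.

Section SCA.
Variables (R : realType) (V : finType) (J : V -> V -> R) (h : V -> R).
Implicit Types (sigma tau : spin_config V) (x y : V).

Definition cavity_field sigma x : R :=
  \sum_(y : V) J x y * spin R sigma y + h x.

Definition flip_prob (beta : R) sigma x : R :=
  expR (- (beta / 2 * cavity_field sigma x * spin R sigma x)) /
  (2 * cosh (beta / 2 * cavity_field sigma x)).

Definition SCA_kernel (beta eps : R) sigma tau : R :=
  (\prod_(x : V | tau x == ~~ sigma x) (eps * flip_prob beta sigma x)) *
  (\prod_(y : V | tau y == sigma y) (1 - eps * flip_prob beta sigma y)).

(* The sums are nonnegative for beta >= 0, so the initial value 0 does not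
   affect the maximum. *)
Definition contraction_rate (beta eps : R) : R :=
  (1 - eps) +
  eps * \big[Num.max/0]_(x : V) \sum_(y : V) tanh (beta * `|J x y| / 2).

End SCA.

(* Main.v *)
Require Import Defs.
From mathcomp Require Import all_boot all_order all_algebra.
From mathcomp Require Import all_classical all_reals all_analysis.
From mathcomp Require Import ring lra.
Import Order.TTheory GRing.Theory Num.Theory.
Local Open Scope ring_scope.

(** The proof is the dual form of path coupling: instead of coupling two copies
of the chain, it follows the action of the kernel on functions
[f : spin_config V -> R] and measures [f] by its one-flip oscillation, the
largest change of [f] under a single spin flip ([flip_lipschitz]).

Given [sigma], the next configuration has independent spins, that is, a
product law whose parameters are the probabilities [plus_prob sigma y] of
seeing +1 at [y].  When the parameters of a product law move from [q] to [q'],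
the mean of [f] moves by at most the oscillation of [f] times the sum of the
[`|q y - q' y|] ([product_mean_lipschitz]).  Flipping the spin at [x] in
[sigma] changes the parameter at [x] itself by [1 - eps], because [J x x = 0],
and the parameter at [y != x] by at most [eps * tanh (beta * `|J x y| / 2)].
These changes add up to at most the contraction rate [r]
([plus_prob_flip_sum]), so one step of the chain multiplies the oscillation
of any function by at most [r] ([SCA_contraction]).

Two configurations differ by at most [#|V|] flips, so after [t] steps the means
of a function of oscillation at most 1 started from two configurations differ
by at most [r ^+ t * #|V|].  Total variation distance is attained at such a
function, half the sign of the difference of the two laws, and a stationary law
averages over starting points ([tv_stationary_le]).  Hence [r ^+ t * #|V|]
bounds the distance to equilibrium, and the announced [t] makes it at most
[delta].

The equilibrium law is whatever stationary law the choice operator returns, so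
the existence of one must be proved ([stationary_exists]). *)

(** * Stationary laws of finite stochastic kernels *)

Definition kernel_mean {R : realType} {S : finType} (K : S -> S -> R)
  (f : S -> R) (s : S) : R := \sum_u K s u * f u.

Definition is_stochastic {R : realType} {S : finType} (K : S -> S -> R) :=
  (forall s u, 0 <= K s u) /\ (forall s, \sum_u K s u = 1).

(** Since [K] fixes the constant column vector, [K - 1] is singular and [K] has
a nonzero left fixed vector [w].  The triangle inequality gives
[`|w| <= `|w| K] entrywise, and both sides have the same total mass because the
rows of [K] sum to 1.  So [`|w|] is also fixed, and it only remains to
normalize it. *)
Lemma stationary_exists {R : realType} {S : finType} (K : S -> S -> R) (s0 : S) :
  is_stochastic K -> exists pi, is_stationary K pi.
Proof.
move=> [K_ge0 K1].
have enumE (F : S -> R) : \sum_(i < #|S|) F (enum_val i) = \sum_s F s.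
  by rewrite [RHS](reindex _ (onW_bij _ (enum_val_bij S))).
pose A := \matrix_(i < #|S|, j < #|S|)
  (K (enum_val i) (enum_val j) - (i == j)%:R).
have detA : \det A == 0.
  rewrite -det_tr; apply/det0P; exists (const_mx 1).
    apply/eqP => /matrixP/(_ ord0 (enum_rank s0)).
    by rewrite !mxE => /eqP; rewrite oner_eq0.
  apply/matrixP => i j; rewrite !mxE.
  under eq_bigr do rewrite !mxE mul1r.
  rewrite sumrB (enumE (fun u => K (enum_val j) u)) K1.
  rewrite (bigD1 j) //= eqxx big1 ?addr0 ?subrr //.
  by move=> k; rewrite eq_sym => /negbTE ->.
have /det0P [v v_neq0 vA] := detA.
pose w s := v ord0 (enum_rank s).
have wK u : \sum_s w s * K s u = w u.
  have /matrixP/(_ ord0 (enum_rank u)) := vA.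
  rewrite !mxE; under eq_bigr do rewrite mxE mulrBr.
  rewrite sumrB => /eqP; rewrite subr_eq0 => /eqP.
  rewrite [RHS](bigD1 (enum_rank u)) //= eqxx mulr1 [X in _ + X]big1; last first.
    by move=> k /negbTE ->; rewrite mulr0.
  rewrite addr0 -/(w u) => <-; rewrite -(enumE (fun s => w s * K s u)).
  by apply: eq_bigr => i _; rewrite /w enum_valK enum_rankK.
pose Z := \sum_s `|w s|.
have Z_gt0 : 0 < Z.
  rewrite lt_def sumr_ge0 // andbT; apply: contraNneq v_neq0 => /psumr_eq0P Z0.
  apply/eqP/matrixP => i j; rewrite ord1 mxE.
  apply/eqP; rewrite -normr_eq0 -[j]enum_valK; apply/eqP.
  exact: (Z0 (fun _ _ => normr_ge0 _)).
have absK u : \sum_s `|w s| * K s u = `|w u|.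
  have le_abs t : 0 <= \sum_s `|w s| * K s t - `|w t|.
    rewrite subr_ge0 -[in leLHS]wK (le_trans (ler_norm_sum _ _ _)) //.
    by apply: ler_sum => s _; rewrite normrM (ger0_norm (K_ge0 s t)).
  have tot : \sum_t (\sum_s `|w s| * K s t - `|w t|) = 0.
    rewrite sumrB exchange_big /=.
    by under eq_bigr do rewrite -mulr_sumr K1 mulr1; rewrite subrr.
  by apply/eqP; rewrite -subr_eq0 (psumr_eq0P (fun t _ => le_abs t) tot).
exists [ffun s => `|w s| / Z]; split.
- by move=> s; rewrite ffunE divr_ge0 // ltW.
- under eq_bigr do rewrite ffunE.
  by rewrite -mulr_suml divff // gt_eqF.
- move=> u; rewrite ffunE -absK mulr_suml; apply: eq_bigr => s _.
  by rewrite ffunE mulrAC.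
Qed.

Lemma kernel_mean_pow0 {R : realType} {S : finType} (K : S -> S -> R) f s :
  kernel_mean (kernel_pow K 0) f s = f s.
Proof.
rewrite /kernel_mean (bigD1 s) //= eqxx mul1r big1 ?addr0 // => u.
by rewrite eq_sym => /negbTE ->; rewrite mul0r.
Qed.

Lemma kernel_mean_powS {R : realType} {S : finType} (K : S -> S -> R) t f s :
  kernel_mean (kernel_pow K t.+1) f s =
  kernel_mean K (kernel_mean (kernel_pow K t) f) s.
Proof.
rewrite /kernel_mean /=; under eq_bigr do rewrite mulr_suml.
rewrite exchange_big /=; apply: eq_bigr => v _.
by rewrite mulr_sumr; apply: eq_bigr => u _; rewrite mulrA.
Qed.

Lemma stationary_mean {R : realType} {S : finType} (K : S -> S -> R) pi t f :
  is_stationary K pi ->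
  \sum_s pi s * kernel_mean (kernel_pow K t) f s = \sum_s pi s * f s.
Proof.
move=> [_ _ piK]; elim: t => [|t IHt].
  by under eq_bigr do rewrite kernel_mean_pow0.
rewrite -IHt; under eq_bigr do rewrite kernel_mean_powS /kernel_mean mulr_sumr.
rewrite exchange_big /=; apply: eq_bigr => v _.
by under eq_bigr do rewrite mulrA; rewrite -mulr_suml piK.
Qed.

(** The [f] for which the oscillation bound is used is half the sign of
[kernel_pow K t s - pi]: the distance is then the gap between the means of [f]
under the two laws, and stationarity turns the mean under [pi] into an average
over starting points [v] of the mean after [t] steps. *)
Lemma tv_stationary_le {R : realType} {S : finType} (K : S -> S -> R) pi t s c :
  is_stationary K pi ->
  (forall f u v, (forall w, `|f w| <= 2^-1) ->
    `|kernel_mean (kernel_pow K t) f u - kernel_mean (kernel_pow K t) f v| <= c) ->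
  tv_distance (kernel_pow K t s) pi <= c.
Proof.
move=> stat osc; have [pi_ge0 pi1 _] := stat.
pose f u := 2^-1 * Num.sg (kernel_pow K t s u - pi u).
have f_le w : `|f w| <= 2^-1.
  rewrite normrM ger0_norm // ler_piMr //.
  by rewrite normr_sg; case: (_ != 0).
have -> : tv_distance (kernel_pow K t s) pi =
    \sum_v pi v * (kernel_mean (kernel_pow K t) f s
                   - kernel_mean (kernel_pow K t) f v).
  under [RHS]eq_bigr do rewrite mulrBr.
  rewrite sumrB (stationary_mean _ _ _ _ stat) -mulr_suml pi1 mul1r.
  rewrite /kernel_mean -sumrB /tv_distance mulr_sumr; apply: eq_bigr => u _.
  by rewrite -mulrBl normrEsg /f; ring.
apply: (@le_trans _ _ (\sum_v pi v * c)); last by rewrite -mulr_suml pi1 mul1r.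
apply: ler_sum => v _; apply: ler_wpM2l => //.
exact: le_trans (ler_norm _) (osc _ _ _ f_le).
Qed.

(** * Product laws on spin configurations *)

Definition flip {V : finType} (y : V) (tau : spin_config V) : spin_config V :=
  [ffun x => (x == y) (+) tau x].

Lemma flipK {V : finType} (y : V) : involutive (flip y).
Proof. by move=> tau; apply/ffunP => x; rewrite !ffunE addKb. Qed.

(** Equivalent to being [L]-Lipschitz for the Hamming distance. *)
Definition flip_lipschitz {R : realType} {V : finType} (L : R)
    (f : spin_config V -> R) :=
  forall tau y, `|f (flip y tau) - f tau| <= L.

Definition spin_weight {R : realType} (p : R) (b : bool) : R :=
  if b then p else 1 - p.

Definition product_law {R : realType} {V : finType} (q : V -> R)
    (tau : spin_config V) : R :=
  \prod_x spin_weight (q x) (tau x).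

Definition product_mean {R : realType} {V : finType} (q : V -> R)
    (f : spin_config V -> R) : R :=
  \sum_tau product_law q tau * f tau.

Definition is_parameter {R : realType} {V : finType} (q : V -> R) :=
  forall x, 0 <= q x <= 1.

Lemma spin_weight_ge0 {R : realType} (p : R) b :
  0 <= p <= 1 -> 0 <= spin_weight p b.
Proof. by case/andP => ? ?; case: b; rewrite /= ?subr_ge0. Qed.

Lemma sum_prod_config {R : realType} {V : finType} (F : V -> bool -> R) :
  \sum_(tau : spin_config V) \prod_x F x (tau x) =
  \prod_x (F x true + F x false).
Proof.
rewrite -(bigA_distr_bigA F); apply: eq_bigr => x _.
by rewrite big_bool.
Qed.

Lemma product_law_ge0 {R : realType} {V : finType} (q : V -> R) tau :
  is_parameter q -> 0 <= product_law q tau.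
Proof. by move=> q01; apply: prodr_ge0 => x _; apply: spin_weight_ge0. Qed.

Lemma product_law_sum {R : realType} {V : finType} (q : V -> R) :
  \sum_tau product_law q tau = 1.
Proof.
rewrite (sum_prod_config (fun x b => spin_weight (q x) b)) big1 // => x _.
by rewrite /= addrC subrK.
Qed.

(** The spins away from [y] have the same law under [q] and [q'], so the
difference of the means is [q y - q' y] times an average of
[f] with +1 at [y] minus [f] with -1 at [y].  That average is obtained by
pairing each configuration with its flip at [y]. *)
Lemma product_mean_step {R : realType} {V : finType} (q q' : V -> R) y L f :
  is_parameter q -> (forall x, x != y -> q' x = q x) -> flip_lipschitz L f ->
  `|product_mean q f - product_mean q' f| <= L * `|q y - q' y|.
Proof.
move=> q01 qq' fL.
pose W (tau : spin_config V) : R := \prod_(x | x != y) spin_weight (q x) (tau x).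
pose d := q y - q' y.
pose sgn (b : bool) : R := if b then 1 else -1.
have W_ge0 tau : 0 <= W tau by apply: prodr_ge0 => x _; apply: spin_weight_ge0.
have Wflip tau : W (flip y tau) = W tau.
  by apply: eq_bigr => x /negbTE xy; rewrite ffunE xy.
(* The value at [y] is free, so the law of the other spins is counted twice. *)
have W2 : \sum_tau W tau = 2.
  under eq_bigr do rewrite /W big_mkcond.
  rewrite (sum_prod_config (fun x b => if x != y then spin_weight (q x) b else 1)).
  rewrite (bigD1 y) //= eqxx /= big1 ?mulr1 // => x ->.
  by rewrite /= addrC subrK.
have diffE : product_mean q f - product_mean q' f =
    \sum_tau W tau * sgn (tau y) * d * f tau.
  rewrite -sumrB; apply: eq_bigr => tau _.
  rewrite /product_law (bigD1 y) //= [X in _ - X * _](bigD1 y) //=.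
  rewrite (_ : \prod_(x | x != y) spin_weight (q' x) (tau x) = W tau).
    by rewrite -/(W tau) /sgn /d /spin_weight; case: (tau y); ring.
  by apply: eq_bigr => x xy; rewrite qq'.
have diff_flipE : product_mean q f - product_mean q' f =
    \sum_tau W tau * - sgn (tau y) * d * f (flip y tau).
  rewrite diffE (reindex_inj (inv_inj (flipK y))) /=; apply: eq_bigr => tau _.
  by rewrite Wflip ffunE eqxx /= /sgn; case: (tau y) => //=; rewrite opprK.
(* Averaging the two expressions of the difference brings in single flips. *)
have -> : product_mean q f - product_mean q' f =
    2^-1 * \sum_tau W tau * - sgn (tau y) * d * (f (flip y tau) - f tau).
  under eq_bigr do rewrite mulrBr.
  rewrite sumrB -diff_flipE.
  rewrite (_ : \sum_tau W tau * - sgn (tau y) * d * f tau =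
     - (product_mean q f - product_mean q' f)); first by field.
  by rewrite diffE -sumrN; apply: eq_bigr => tau _; ring.
rewrite normrM ger0_norm //.
apply: (@le_trans _ _ (2^-1 * \sum_tau W tau * `|d| * L)).
  apply: ler_wpM2l => //; apply: le_trans (ler_norm_sum _ _ _) _.
  apply: ler_sum => tau _; rewrite !normrM (ger0_norm (W_ge0 _)).
  rewrite (_ : `|- sgn (tau y)| = 1) ?mulr1; last first.
    by rewrite normrN /sgn; case: (tau y); rewrite ?normrN normr1.
  by apply: ler_wpM2l => //; rewrite mulr_ge0.
by rewrite -!mulr_suml W2 mulrA (mulrC L) mulrA mulVf // mul1r.
Qed.

(** Change the parameters one vertex at a time. *)
Lemma product_mean_lipschitz {R : realType} {V : finType} (q q' : V -> R) L f :
  is_parameter q -> is_parameter q' -> flip_lipschitz L f ->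
  `|product_mean q f - product_mean q' f| <= L * \sum_y `|q y - q' y|.
Proof.
move=> q01 q'01 fL.
pose mix (s : seq V) x := if x \in s then q' x else q x.
have mix01 s : is_parameter (mix s) by move=> x; rewrite /mix; case: ifP.
have step s : uniq s ->
    `|product_mean q f - product_mean (mix s) f| <= L * \sum_(y <- s) `|q y - q' y|.
  elim: s => [_|y s IHs /= /andP[ys us]].
    by rewrite (_ : mix [::] = q) // subrr normr0 big_nil mulr0.
  rewrite big_cons mulrDr [leRHS]addrC.
  apply: le_trans (ler_distD (product_mean (mix s) f) _ _) _.
  apply: lerD; first exact: IHs.
  have := product_mean_step (mix s) (mix (y :: s)) y L f (mix01 s).
  rewrite /mix inE eqxx (negbTE ys) /=; apply => // x /negbTE xy.
  by rewrite inE xy.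
have := step (enum V) (enum_uniq V).
rewrite big_enum /= (_ : mix (enum V) = q') //.
by apply/funext => x; rewrite /mix mem_enum.
Qed.

(** Parameters in {0, 1} give a point mass, which makes the Hamming-distance
bound [flip_lipschitz_diameter] a special case of [product_mean_lipschitz]. *)
Lemma product_mean_dirac {R : realType} {V : finType} (sigma : spin_config V)
    (f : spin_config V -> R) :
  product_mean (fun x => (sigma x)%:R) f = f sigma.
Proof.
rewrite /product_mean (bigD1 sigma) //= big1 ?addr0 => [|tau ne].
  rewrite /product_law big1 ?mul1r // => x _.
  by case: (sigma x); rewrite /= ?subr0.
have [x neq] : exists x, tau x != sigma x.
  by apply/existsP; rewrite -negb_forall; apply: contra ne => /eqfunP/ffunP/eqP.
rewrite /product_law (bigD1 x) //=.
by case: (tau x) (sigma x) neq => [] [] //= _; rewrite ?subrr !mul0r.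
Qed.

Lemma flip_lipschitz_diameter {R : realType} {V : finType} (L : R)
    (f : spin_config V -> R) sigma tau :
  0 <= L -> flip_lipschitz L f -> `|f sigma - f tau| <= L * #|V|%:R.
Proof.
move=> L_ge0 fL.
have dirac01 (rho : spin_config V) : is_parameter (fun x => (rho x)%:R : R).
  by move=> x; case: (rho x); rewrite /= ?lexx ler01.
rewrite -[f sigma]product_mean_dirac -[f tau]product_mean_dirac.
apply: le_trans (product_mean_lipschitz _ _ L f (dirac01 _) (dirac01 _) fL) _.
apply: ler_wpM2l => //; rewrite -sum1_card natr_sum; apply: ler_sum => x _.
by case: (sigma x) (tau x) => [] []; rewrite ?subrr ?normr0 ?subr0 ?sub0r ?normrN ?normr1.
Qed.

(** * The flip probability as a function of the local field *)

(** This is [(1 - tanh a) / 2], written with a single exponential. *)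
Definition glauber_prob {R : realType} (a : R) : R := (1 + expR a ^+ 2)^-1.

Lemma glauber_prob01 {R : realType} (a : R) : 0 <= glauber_prob a <= 1.
Proof.
have e2 := sqr_ge0 (expR a).
rewrite /glauber_prob invr_ge0 invf_le1; last by rewrite ltr_pwDl.
by rewrite addr_ge0 //= lerDl.
Qed.

Lemma glauber_probN {R : realType} (a : R) :
  glauber_prob (- a) = 1 - glauber_prob a.
Proof.
have e0 := expR_gt0 a; have e2 := sqr_ge0 (expR a).
rewrite /glauber_prob expRN; field.
by rewrite !gt_eqF //= ltr_pwDl ?exprn_gt0.
Qed.

(** With [c = expR a] and [d = expR b], the two sides are
[(d - c) (d + c) / ((1 + c^2) (1 + d^2))] and [(d - c) / (d + c)].  They compare
because [(1 + c^2) (1 + d^2) = (d + c)^2 + (1 - c d)^2]. *)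
Lemma glauber_prob_lipschitz {R : realType} (a b : R) :
  `|glauber_prob a - glauber_prob b| <= tanh (`|a - b| / 2).
Proof.
wlog ab : a b / a <= b => [hw|].
  have [/hw//|/ltW/hw] := leP a b.
  by rewrite distrC (distrC b).
rewrite (distrC a b) [`|b - a|]ger0_norm ?subr_ge0 //.
pose c := expR a; pose d := expR b.
have c0 : 0 < c by apply: expR_gt0.
have d0 : 0 < d by apply: expR_gt0.
have cd : c <= d by rewrite ler_expR.
have -> : tanh ((b - a) / 2) = (d - c) / (d + c).
  have e0 := expR_gt0 ((b - a) / 2).
  have -> : d = c * expR ((b - a) / 2) ^+ 2.
    by rewrite /d /c expr2 -!expRD; congr expR; field.
  rewrite /tanh /sinh /cosh expRN; set e := expR _ in e0 *.
  field; rewrite !gt_eqF //.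
  - by rewrite addr_gt0 // mulr_gt0.
  - by rewrite addr_gt0 // mulr_gt0 // exprn_gt0.
have c2 : 0 < 1 + c ^+ 2 by rewrite ltr_pwDl // sqr_ge0.
have d2 : 0 < 1 + d ^+ 2 by rewrite ltr_pwDl // sqr_ge0.
have -> : glauber_prob a - glauber_prob b =
    (d - c) * (d + c) / ((1 + c ^+ 2) * (1 + d ^+ 2)).
  by rewrite /glauber_prob -/c -/d; field; rewrite !gt_eqF.
rewrite ger0_norm; last first.
  by rewrite divr_ge0 ?mulr_ge0 ?subr_ge0 // ltW // addr_gt0.
rewrite ler_pdivrMr ?mulr_gt0 // -!mulrA; apply: ler_wpM2l.
  by rewrite subr_ge0.
rewrite mulrC ler_pdivlMr ?addr_gt0 // -subr_ge0.
rewrite (_ : _ - _ = (1 - c * d) ^+ 2) ?sqr_ge0 //; ring.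
Qed.

(** * Contraction of the cellular automaton *)

Section Dynamics.
Variables (R : realType) (V : finType) (J : V -> V -> R) (h : V -> R).
Variables (beta eps : R).
Hypotheses (J_sym : forall x y, J x y = J y x) (J_diag : forall x, J x x = 0).
Hypotheses (eps_gt0 : 0 < eps) (eps_le1 : eps <= 1) (beta_ge0 : 0 <= beta).
Implicit Types (sigma tau : spin_config V) (x y : V).

Let eps_ge0 : 0 <= eps := ltW eps_gt0.

Definition local_field sigma x : R :=
  beta / 2 * cavity_field J h sigma x * spin R sigma x.

Lemma flip_probE sigma x :
  flip_prob J h beta sigma x = glauber_prob (local_field sigma x).
Proof.
rewrite /flip_prob /glauber_prob /local_field.
set a := beta / 2 * _.
have e0 := expR_gt0 a; have e2 := sqr_ge0 (expR a).
rewrite /cosh /spin; case: (sigma x); rewrite ?mulr1 ?mulrN1 ?opprK expRN;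
  by field; rewrite !gt_eqF //= ltr_pwDl ?exprn_gt0.
Qed.

Definition plus_prob sigma x : R :=
  spin_weight (1 - eps * flip_prob J h beta sigma x) (sigma x).

Lemma plus_prob01 sigma : is_parameter (plus_prob sigma).
Proof.
move=> x; rewrite /plus_prob flip_probE.
have /andP[g0 g1] := glauber_prob01 (local_field sigma x).
have eg0 : 0 <= eps * glauber_prob (local_field sigma x) by rewrite mulr_ge0.
have eg1 : eps * glauber_prob (local_field sigma x) <= 1 by rewrite mulr_ile1.
by case: (sigma x) => /=; apply/andP; split; lra.
Qed.

Lemma SCA_kernelE sigma tau :
  SCA_kernel J h beta eps sigma tau = product_law (plus_prob sigma) tau.
Proof.
rewrite /SCA_kernel /product_law [RHS](bigID (fun x => tau x == ~~ sigma x)) /=.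
congr (_ * _).
  apply: eq_bigr => x /eqP ->; rewrite /plus_prob.
  by case: (sigma x) => /=; ring.
apply: eq_big => x; first by case: (tau x) (sigma x) => [] [].
by move=> /eqP ->; rewrite /plus_prob; case: (sigma x) => /=; ring.
Qed.

Lemma SCA_stochastic : is_stochastic (SCA_kernel J h beta eps).
Proof.
split=> [s u|s]; first by rewrite SCA_kernelE product_law_ge0 //; apply: plus_prob01.
by under eq_bigr do rewrite SCA_kernelE; rewrite product_law_sum.
Qed.

Lemma spin_flip x sigma y :
  spin R (flip x sigma) y = if y == x then - spin R sigma y else spin R sigma y.
Proof.
by rewrite /spin ffunE; case: (y == x); case: (sigma y); rewrite /= ?opprK.
Qed.

Lemma cavity_field_flip x sigma y :
  cavity_field J h (flip x sigma) y =
  cavity_field J h sigma y - 2 * J y x * spin R sigma x.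
Proof.
rewrite /cavity_field (bigD1 x) //= [in RHS](bigD1 x) //= spin_flip eqxx.
rewrite (eq_bigr (fun z => J y z * spin R sigma z)); last first.
  by move=> z /negbTE zx; rewrite spin_flip zx.
by ring.
Qed.

(** The cavity field at [x] does not see the spin at [x], so flipping it only
reverses the local field: the flip probabilities before and after sum to 1. *)
Lemma plus_prob_flip_self x sigma :
  `|plus_prob (flip x sigma) x - plus_prob sigma x| = 1 - eps.
Proof.
rewrite /plus_prob !flip_probE /local_field cavity_field_flip J_diag.
rewrite spin_flip eqxx mulr0 mul0r subr0 mulrN glauber_probN ffunE eqxx.
rewrite -[RHS]ger0_norm ?subr_ge0 //; case: (sigma x) => /=; last first.
  by congr `|_|; ring.
by rewrite -[RHS]normrN; congr `|_|; ring.
Qed.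

(** The flip at [x] moves the local field at [y] by [beta * J y x], up to sign. *)
Lemma plus_prob_flip_other x sigma y : y != x ->
  `|plus_prob (flip x sigma) y - plus_prob sigma y| <=
    eps * tanh (beta * `|J x y| / 2).
Proof.
move=> /negbTE yx; rewrite /plus_prob !flip_probE ffunE yx /=.
set a := local_field (flip x sigma) y; set b := local_field sigma y.
have -> : beta * `|J x y| = `|a - b|.
  rewrite /a /b /local_field spin_flip yx cavity_field_flip J_sym.
  rewrite -[beta in LHS]ger0_norm // -normrM /spin.
  by case: (sigma x); case: (sigma y) => /=;
    [rewrite -normrN| | |rewrite -normrN]; congr `|_|; field.
rewrite (_ : `|_ - _| = eps * `|glauber_prob a - glauber_prob b|).
  by apply: ler_wpM2l => //; apply: glauber_prob_lipschitz.
rewrite -[in RHS](ger0_norm eps_ge0) -normrM.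
by case: (sigma y) => /=; [rewrite -normrN|]; congr `|_|; ring.
Qed.

(** The term [y = x] of the sum in the contraction rate is [tanh 0 = 0]. *)
Lemma plus_prob_flip_sum x sigma :
  \sum_y `|plus_prob (flip x sigma) y - plus_prob sigma y| <=
  contraction_rate J beta eps.
Proof.
rewrite (bigD1 x) //= plus_prob_flip_self /contraction_rate; apply: lerD => //.
apply: le_trans (ler_sum _ (fun y => @plus_prob_flip_other x sigma y)) _.
rewrite -mulr_sumr; apply: ler_wpM2l => //.
apply: le_trans (le_bigmax _ _ x).
rewrite [leRHS](bigD1 x) //= J_diag normr0 mulr0 mul0r.
by rewrite /tanh /sinh oppr0 subrr !mul0r add0r.
Qed.

Lemma SCA_contraction L f : 0 <= L -> flip_lipschitz L f ->
  flip_lipschitz (contraction_rate J beta eps * L)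
    (kernel_mean (SCA_kernel J h beta eps) f).
Proof.
move=> L_ge0 fL sigma x.
have meanE rho : kernel_mean (SCA_kernel J h beta eps) f rho =
    product_mean (plus_prob rho) f.
  by apply: eq_bigr => tau _; rewrite SCA_kernelE.
rewrite !meanE mulrC.
apply: le_trans (product_mean_lipschitz _ _ L f (plus_prob01 _) (plus_prob01 _) fL) _.
by apply: ler_wpM2l => //; apply: plus_prob_flip_sum.
Qed.

Lemma SCA_pow_contraction t f : 0 <= contraction_rate J beta eps ->
  flip_lipschitz 1 f ->
  flip_lipschitz (contraction_rate J beta eps ^+ t)
    (kernel_mean (kernel_pow (SCA_kernel J h beta eps) t) f).
Proof.
move=> r_ge0 f1; elim: t => [|t IHt] sigma x.
  by rewrite !kernel_mean_pow0 expr0.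
rewrite !kernel_mean_powS exprS; apply: SCA_contraction => //.
exact: exprn_ge0.
Qed.

Lemma SCA_distance_le t : 0 <= contraction_rate J beta eps ->
  distance_to_equilibrium (SCA_kernel J h beta eps) t <=
  contraction_rate J beta eps ^+ t * #|V|%:R.
Proof.
move=> r_ge0; have rt_ge0 := exprn_ge0 t r_ge0.
have [pi pi_stat] :=
  stationary_exists _ ([ffun => true] : spin_config V) SCA_stochastic.
apply/bigmax_leP; split=> [|s _]; first by rewrite mulr_ge0.
apply: tv_stationary_le; first exact: (xgetI _ pi_stat).
move=> f u v f_le; apply: flip_lipschitz_diameter => //.
apply: SCA_pow_contraction => // tau y.
apply: le_trans (ler_normB _ _) _.
by have := f_le (flip y tau); have := f_le tau; lra.
Qed.

End Dynamics.

(** * From contraction to the mixing time *)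

(** Taking logarithms, [r ^+ t * n <= delta] says
[ln n - ln delta <= t * ln (1 / r)].  For [n = 0] this rewriting is not
available, but then the bound is trivial, and the quotient is still nonnegative
because [ln 0 = 0]. *)
Lemma geometric_le_at_ceil {R : realType} (n : nat) (r delta : R) :
  0 < r -> r < 1 -> 0 < delta -> delta <= 1 ->
  exists2 t : nat, r ^+ t * n%:R <= delta &
    (t%:R : R) = (Num.ceil ((ln (n%:R : R) - ln delta) / ln (1 / r)))%:~R.
Proof.
move=> r_gt0 r_lt1 delta_gt0 delta_le1.
have lnr_gt0 : 0 < ln (1 / r) by rewrite ln_gt0 // div1r invf_gt1.
have lnn_ge0 : 0 <= ln (n%:R : R).
  by case: n => [|n]; [rewrite ln0|rewrite ln_ge0 // ler1n].
set x := _ / ln (1 / r).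
have x_ge0 : 0 <= x by rewrite divr_ge0 ?(ltW lnr_gt0) // subr_ge0 (le_trans (ln_le0 _) lnn_ge0).
have c_ge0 : 0 <= Num.ceil x by rewrite ceil_ge0 (lt_le_trans _ x_ge0) ?ltrN10.
exists `|Num.ceil x|%N; last by rewrite -[in RHS](gez0_abs c_ge0).
set t := `|_|%N.
have xt : x <= t%:R.
  by rewrite (_ : t%:R = (Num.ceil x)%:~R) ?ceil_ge // -[in RHS](gez0_abs c_ge0).
case: n lnn_ge0 @x x_ge0 c_ge0 @t xt => [|n] _ x _ _ t xt; first by rewrite mulr0 ltW.
have n_gt0 : (0 : R) < n.+1%:R by [].
rewrite -ler_ln ?posrE ?mulr_gt0 ?exprn_gt0 // lnM ?posrE ?exprn_gt0 // lnXn //.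
move: xt; rewrite /x ler_pdivrMr // div1r lnV ?posrE // mulrN mulr_natl; lra.
Qed.

Theorem theorem2p2 (R : realType)
    (V : finType) (E : rel V) (E_sym : symmetric E) (E_irr : irreflexive E)
    (J : V -> V -> R) (h : V -> R)
    (J_sym : forall x y, J x y = J y x)
    (J_supp : forall x y, ~~ E x y -> J x y = 0)
    (beta eps delta : R)
    (beta_ge0 : 0 <= beta)
    (eps_gt0 : 0 < eps) (eps_le1 : eps <= 1)
    (delta_gt0 : 0 < delta) (delta_le1 : delta <= 1)
    (r_gt0 : 0 < contraction_rate J beta eps)
    (r_lt1 : contraction_rate J beta eps < 1) :
  (mixing_time (SCA_kernel J h beta eps) delta <=
   ((Num.ceil ((ln (#|V|%:R : R) - ln delta) /
               ln (1 / contraction_rate J beta eps)))%:~R)%:E)%E.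
Proof.
have J_diag x : J x x = 0 by rewrite J_supp // E_irr.
have [t rt_le <-] := geometric_le_at_ceil #|V| _ _ r_gt0 r_lt1 delta_gt0 delta_le1.
apply: ereal_inf_lbound; exists t => //=.
by apply: le_trans rt_le; apply: SCA_distance_le => //; apply: ltW.
Qed.
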